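(* Let $r,n$ be positive integers and let $g$ be a uniformly distributed random element of the symmetric group $S_n$. Then for a fixed value of $r$ and sufficiently large $n$, the following hold. (a) The conditional probability $P$ that $g$ is an $n$-cycle, given that $|g|$ divides $rn$, satisfies $$1-\frac{c(r)}{n}-O\left(\frac{1}{n^{1.5-o(1)}}\right)\leq P\leq 1-\frac{c(r)}{n}+O\left(\frac{1}{n^{2}}\right).$$ (b) If $r=t!-1$ for a positive integer $t$, then the conditional probability $P$ that $g$ contains an $(n-t)$-cycle, given that $|g|$ divides $t!(n-t)$, satisfies $$1-\frac{c'(r)}{n}-O\left(\frac{1}{n^{1.5-o(1)}}\right)\leq P\leq 1-\frac{c'(r)}{n}+O\left(\frac{1}{n^{2}}\right).$$
   Context: $|g|$ denotes the order of the permutation $g$. ''Contains an $(n-t)$-cycle'' means that the disjoint cycle decomposition of $g$ contains a cycle of length $n-t$. In (a), $c(r)=\sum\left(1+\frac{i+j}{2r}\right)$, where the sum is over all ordered pairs $(i,j)$ of integers such that $1\leq i,j\leq r^2$, $ij=r^2$, and both $r+i$ and $r+j$ divide $rn$. In (b), with $m=t!(n-t)$, $c'(r)=\sum\left(1+\frac{i+j-2}{2(r+1)}\right)$, where the sum is over all ordered pairs $(i,j)$ of integers such that $1<i,j\leq (r+1)^2+1$, $(i-1)(j-1)=(r+1)^2$, and both $r+i$ and $r+j$ divide $m$. The asymptotic notation is for $n\to\infty$ with $r$ fixed. Each $O(\cdot)$ denotes a quantity bounded in absolute value by a constant depending only on $r$ times the indicated function; $O(1/n^{1.5-o(1)})$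 denotes a quantity such that for every $\varepsilon>0$ there are constants $C,N$ depending only on $r$ and $\varepsilon$ for which it is at most $C n^{-1.5+\varepsilon}$ in absolute value for all $n\ge N$. *)

(* Defs.v *)
From HB Require Import structures.
From mathcomp Require Import all_boot all_order all_algebra all_fingroup.
From mathcomp Require Import all_classical all_reals all_analysis.

Set Implicit Arguments.
Unset Strict Implicit.
Unset Printing Implicit Defensive.

Import Order.TTheory GRing.Theory Num.Theory.
Import numFieldNormedType.Exports.

Local Open Scope ring_scope.

Definition unif_prob (R : realType) (T : finType) (A : {set T}) : R :=
  #|A|%:R / #|T|%:R.

Definition cond_prob (R : realType) (T : finType) (A B : {set T}) : R :=
  unif_prob R (A :&: B) / unif_prob R B.

(* The orbits of g are the supports of the cycles of its disjoint cycle
   decomposition, fixed points counting as 1-cycles. *)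
Definition contains_cycle (n k : nat) (g : 'S_n) : bool :=
  [exists X in porbits g, #|X| == k].

(* On 'I_n, an n-cycle is exactly a permutation containing an n-cycle. *)
Definition cycle_cond_prob (R : realType) (n k d : nat) : R :=
  cond_prob R [set g : 'S_n | contains_cycle k g]
              [set g : 'S_n | (#[g]%g %| d)%N].

Definition c_const (R : realType) (r n : nat) : R :=
  \sum_(1 <= i < (r ^ 2).+1)
    \sum_(1 <= j < (r ^ 2).+1 |
          [&& (i * j == r ^ 2)%N, (r + i %| r * n)%N & (r + j %| r * n)%N])
      (1 + (i%:R + j%:R) / (2 * r%:R)).

Definition c'_const (R : realType) (r m : nat) : R :=
  \sum_(2 <= i < (r.+1 ^ 2).+2)
    \sum_(2 <= j < (r.+1 ^ 2).+2 |
          [&& (i.-1 * j.-1 == r.+1 ^ 2)%N, (r + i %| m)%N & (r + j %| m)%N])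
      (1 + (i%:R + j%:R - 2) / (2 * r.+1%:R)).

Local Open Scope classical_set_scope.

(* E is O(1 / n^(a - o(1))) as n tends to infinity. *)
Definition bigO_inv_pow_o1 (R : realType) (a : R) (E : nat -> R) : Prop :=
  forall eps : R, 0 < eps ->
    E =O_\oo (fun n : nat => n%:R `^ (- a + eps)).

(* P n = 1 - c n / n with error between -O(1 / n^(1.5 - o(1))) and O(1 / n^2). *)
Definition cycle_estimate (R : realType) (P c : nat -> R) : Prop :=
  exists E1 E2 : nat -> R,
    [/\ bigO_inv_pow_o1 (3 / 2) E1,
        E2 =O_\oo (fun n : nat => 1 / n%:R ^+ 2 : R) &
        \forall n \near \oo,
          1 - c n / n%:R - E1 n <= P n /\ P n <= 1 - c n / n%:R + E2 n].

(* Main.v *)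
(* Write a(n) for the proportion of permutations of n points all of whose cycle
   lengths lie in a given set D.  Removing the cycle through a given point shows
   n a(n) = sum_(d in D, d <= n) a(n - d).

   Both parts are the case n = k + t, m = q k, of permutations of order dividing
   m, where every j <= t divides q (with t = 0, q = r in (a) and q = t! in (b)).
   The recurrence splits off the permutations with a k-cycle, of proportion 1/k,
   so that P = 1 / (1 + k b(n)), where b counts with D = divisors of m except k.
   Now b(n) <= tau(m) / n.  Unfolding the recurrence for b twice gives
   n b(n) = sum_(d, d') b(n - d - d') / (n - d).  The pairs with d + d' = k give
   c / k, up to O(1/k^2).  For the others, d = m/a and d' = m/a' with a, a' > q,
   and then n - d - d' is at least a constant multiple of k, uniformly in a, a',
   so they contribute O(tau(m)^3 / k^2).  Finally tau(m)^6 = O(m). *)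

Require Import Defs.
From HB Require Import structures.
From mathcomp Require Import all_boot all_order all_algebra all_fingroup.
From mathcomp Require Import all_classical all_reals all_analysis.
From mathcomp Require Import cyclic zify ring lra.

Import Order.TTheory GRing.Theory Num.Theory.
Import numFieldNormedType.Exports.

Local Open Scope ring_scope.

(** * The recurrence for permutations with restricted cycle lengths *)

(** Fixed points inside [S] count as 1-cycles, and points outside [S] are not tested. Varying [S]
    inside a fixed [T] lets points be deleted without changing the type. *)
Definition perms_with_cycles (T : finType) (D : pred nat) (S : {set T}) :
    {set {perm T}} :=
  [set g | perm_on S g & [forall x in S, D #|porbit g x|]].

(** [D] constrains only the other cycles, so the cycle through [x] can be shortened point by point
    with no condition on the intermediate lengths. *)
Definition perms_with_cycle_at (T : finType) (D : pred nat) (S : {set T})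
    (x : T) (d : nat) : {set {perm T}} :=
  [set g | [&& perm_on S g, #|porbit g x| == d &
            [forall y in S, (y \notin porbit g x) ==> D #|porbit g y|]]].

Lemma perm_on_fix (T : finType) (S : {set T}) (g : {perm T}) (x : T) :
  perm_on (S :\ x) g = perm_on S g && (g x == x).
Proof.
apply/idP/andP => [gS|[/fintype.subsetP gS /eqP gx]].
  split; last by rewrite (out_perm gS) // !inE eqxx.
  by apply: fintype.subset_trans gS _; apply: finset.subD1set.
apply/fintype.subsetP => y; rewrite !inE => gy.
by rewrite gS ?inE // andbT; apply: contra_neq gy => ->.
Qed.

Lemma porbit_fix (T : finType) (g : {perm T}) (x : T) :
  g x = x -> porbit g x = [set x].
Proof.
move=> gx; apply/finset.setP => y; rewrite inE.
apply/porbitP/eqP => [[i ->]|->]; last by exists 0%N; rewrite perm1.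
by rewrite permX; elim: i => //= i ->.
Qed.

Lemma card_porbit_eq1 (T : finType) (g : {perm T}) (x : T) :
  (#|porbit g x| == 1)%N = (g x == x).
Proof.
apply/idP/eqP => [/cards1P[y oE]|/porbit_fix ->]; last by rewrite cards1.
have := porbit_id g x; have := mem_porbit g 1 x.
by rewrite oE expg1 !inE => /eqP -> /eqP ->.
Qed.

Lemma perms_with_cycle_at1 (T : finType) (D : pred nat) (S : {set T}) (x : T) :
  perms_with_cycle_at T D S x 1 = perms_with_cycles T D (S :\ x).
Proof.
apply/finset.setP => g; rewrite !inE perm_on_fix card_porbit_eq1 -andbA.
apply: andb_id2l => _; apply: andb_id2l => /eqP gx.
by apply: eq_forallb => y; rewrite (porbit_fix _ _ _ gx) !inE; case: (y == x);
  rewrite //= implybT.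
Qed.

(** * Inserting a fixed point into a cycle *)

Section InsertPoint.
Variables (T : finType) (h : {perm T}) (x y : T).
Hypotheses (hy : h y = y) (nyx : y != x).
Local Notation g := (tperm x y * h)%g.

Lemma tperm_mul_l : g x = y. Proof. by rewrite permM tpermL. Qed.
Lemma tperm_mul_r : g y = h x. Proof. by rewrite permM tpermR. Qed.
Lemma tperm_mul_out (z : T) : z != x -> z != y -> g z = h z.
Proof. by move=> zx zy; rewrite permM tpermD // eq_sym. Qed.

Lemma fix_notin_porbit : y \notin porbit h x.
Proof. by rewrite porbit_sym (porbit_fix _ _ _ hy) inE eq_sym. Qed.

Lemma porbit_tperm_mul : porbit g x = y |: porbit h x.
Proof.
apply/finset.setP => z; apply/porbitP/idP => [[i ->]|].
  rewrite permX; elim: i => [|i] /=; first by rewrite !inE porbit_id orbT.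
  have hP w : w \in porbit h x -> h w \in porbit h x.
    by case/porbitP => j ->; rewrite -permM -expgSr mem_porbit.
  set w := iter i g x; case: (eqVneq w y) => [->|wy].
    by rewrite tperm_mul_r => _; rewrite !inE hP ?porbit_id ?orbT.
  case: (eqVneq w x) => [->|wx]; first by rewrite tperm_mul_l !inE eqxx.
  by rewrite tperm_mul_out // !inE (negPf wy) /= => /hP ->; rewrite orbT.
move=> zy; apply/porbitP; move: zy; rewrite !inE => /predU1P[->|].
  by rewrite -{1}tperm_mul_l -{1}[g]expg1 mem_porbit.
have gP w : w \in porbit g x -> g w \in porbit g x.
  by case/porbitP => j ->; rewrite -permM -expgSr mem_porbit.
case/porbitP=> i ->; rewrite permX; elim: i => [|i]; first exact: porbit_id.
rewrite iterS; set w := iter i h x => wP.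
have wy : w != y.
  apply: contraNneq fix_notin_porbit => <-.
  by rewrite /w -permX mem_porbit.
case: (eqVneq w x) => [->|wx]; last by rewrite -tperm_mul_out // gP.
(* From [x] the point [h x] is two steps of [g] away, through [y]. *)
by have := gP _ (gP _ (porbit_id g x)); rewrite tperm_mul_l tperm_mul_r.
Qed.

Lemma porbit_tperm_mul_out (z : T) :
  z \notin y |: porbit h x -> porbit g z = porbit h z.
Proof.
rewrite !inE negb_or => /andP[zy zx].
have E i : iter i g z = iter i h z.
  elim: i => //= i ->; apply: tperm_mul_out.
    apply: contraNneq zx => <-; rewrite porbit_sym -permX; exact: mem_porbit.
  apply: contraNneq zy => E; have : y \in porbit h z.
    by rewrite -E -permX mem_porbit.
  by rewrite porbit_sym (porbit_fix _ _ _ hy) inE.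
by apply/finset.setP => u; apply/porbitP/porbitP => -[i ->]; exists i;
  rewrite !permX E.
Qed.

End InsertPoint.

(* [h |-> tperm x y * h] inserts [y] right after [x] in the cycle of [x]. *)
Lemma perms_with_cycle_atS (T : finType) (D : pred nat) (S : {set T})
    (x y : T) (d : nat) : y \in S -> y != x -> x \in S ->
  [set g in perms_with_cycle_at T D S x d.+1 | g x == y] =
  [set (tperm x y * h)%g | h in perms_with_cycle_at T D (S :\ y) x d].
Proof.
move=> yS yx xS; apply/finset.setP => g; pose h := (tperm x y * g)%g.
have gE : g = (tperm x y * h)%g by rewrite /h mulgA tperm2 mul1g.
have -> : (g \in [set (tperm x y * h)%g |
    h in perms_with_cycle_at T D (S :\ y) x d]) =
    (h \in perms_with_cycle_at T D (S :\ y) x d).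
  rewrite {1}gE mem_imset //; exact: mulgI.
have tS : perm_on S (tperm x y).
  apply: fintype.subset_trans (tperm_on x y) _.
  by rewrite finset.subUset !finset.sub1set xS.
have -> : (g \in [set g in perms_with_cycle_at T D S x d.+1 | g x == y]) =
    (h y == y) && (g \in perms_with_cycle_at T D S x d.+1).
  by rewrite inE andbC gE permM tpermL.
rewrite !inE perm_on_fix.
have -> : perm_on S h = perm_on S g.
  by apply/idP/idP => [hS|gS]; [rewrite gE|]; apply: perm_onM.
rewrite [perm_on S g && (h y == y)]andbC -!andbA; apply: andb_id2l => /eqP hy.
apply: andb_id2l => _; rewrite gE.
rewrite porbit_tperm_mul // cardsU1 fix_notin_porbit // add1n eqSS.
apply: andb_id2l => _; apply: eq_forallb => z; rewrite !inE negb_or.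
case: (eqVneq z y) => //= zy; first by rewrite implybT.
case zO: (z \in porbit h x) => //=.
by rewrite porbit_tperm_mul_out // !inE negb_or zy zO.
Qed.

(** Classify by [y = g x], which differs from [x] since the cycle has length at least 2; removing
    [y] from the cycle is then a bijection. *)
Lemma card_perms_with_cycle_atS (T : finType) (D : pred nat) (S : {set T})
    (x : T) (d : nat) : x \in S ->
  #|perms_with_cycle_at T D S x d.+2| =
  (\sum_(y in S :\ x) #|perms_with_cycle_at T D (S :\ y) x d.+1|)%N.
Proof.
move=> xS; rewrite -sum1_card.
rewrite (partition_big (fun g : {perm T} => g x) (mem (S :\ x))) /=; last first.
  move=> g; rewrite !inE => /and3P[gS /eqP gd _].
  by rewrite (perm_closed _ gS) xS -card_porbit_eq1 gd.
apply: eq_bigr => y; rewrite !inE => /andP[yx yS].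
have inj_t : injective (fun h => tperm x y * h)%g := @mulgI _ _.
rewrite -(card_imset _ inj_t) -perms_with_cycle_atS // -sum1_card.
by apply: eq_bigl => g; rewrite [RHS]inE.
Qed.

Lemma card_perms_with_cycles (T : finType) (D : pred nat) (S : {set T})
    (x : T) : x \in S ->
  #|perms_with_cycles T D S| =
  (\sum_(d < #|S| | D d.+1) #|perms_with_cycle_at T D S x d.+1|)%N.
Proof.
move=> xS; rewrite -sum1_card.
have oS g : perm_on S g -> porbit g x \subset S.
  move=> gS; apply/fintype.subsetP => y /porbitP[i ->].
  rewrite permX; elim: i => //= i; by rewrite perm_closed.
(* The classes are lengths minus 1; [inord] is faithful because the cycle of [x] lies in the
   nonempty set [S]. *)
rewrite (partition_big
  (fun g : {perm T} => inord (#|porbit g x|.-1) : 'I_#|S|.-1.+1)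
  (fun d => D d.+1)) /=; last first.
  move=> g; rewrite !inE => /andP[gS /forall_inP /(_ x xS)].
  rewrite inordK; last first.
    by rewrite ltnS -!subn1 leq_sub2r // subset_leq_card // oS.
  by rewrite prednK // lt0n card_porbit_neq0.
have S0 : (0 < #|S|)%N by rewrite card_gt0; apply/finset.set0Pn; exists x.
move: (prednK S0); set s := #|S|.-1 => sE; rewrite -sE.
apply: eq_bigr => d Dd; rewrite -sum1_card; apply: eq_bigl => g; rewrite !inE.
case gS: (perm_on S g) => //=.
have dE : (inord (#|porbit g x|.-1) == d) = (#|porbit g x| == d.+1)%N.
  rewrite -val_eqE /= inordK; last first.
    by rewrite ltnS /s -!subn1 leq_sub2r // subset_leq_card // oS.
  by rewrite -eqSS prednK // lt0n card_porbit_neq0.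
rewrite dE andbC; apply: andb_id2l => /eqP oE.
apply: eq_forallb => y; case: (y \in S) => //=.
case yO: (y \in porbit g x) => //=.
by move: yO; rewrite -eq_porbit_mem => /eqP ->; rewrite oE Dd.
Qed.

Definition num_perms_with_cycles (D : pred nat) (n : nat) : nat :=
  #|perms_with_cycles 'I_n D [set: 'I_n]|.

Lemma perms_with_cycles0 (T : finType) (D : pred nat) :
  perms_with_cycles T D finset.set0 = [set 1%g].
Proof.
apply/finset.setP => g; rewrite !inE; apply/andP/eqP => [[gS _]|->].
  by apply: perm_on_id gS _; rewrite cards0.
by split; [exact: perm_on1|apply/forall_inP => x; rewrite inE].
Qed.

(** The falling factorial counts the ordered choices of the [d] points following [x] in its cycle.
    [Hf] is limited to sizes up to [s] so that this can serve inside the induction showing that the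
    count depends only on [#|S|]. *)
Lemma card_perms_with_cycle_at (T : finType) (D : pred nat) (f : nat -> nat)
    (s : nat) (Hf : forall S : {set T}, (#|S| <= s)%N ->
                      #|perms_with_cycles T D S| = f #|S|)
    (S : {set T}) (x : T) (d : nat) :
  (#|S| <= s.+1)%N -> x \in S ->
  #|perms_with_cycle_at T D S x d.+1| = (#|S|.-1 ^_ d * f (#|S|.-1 - d))%N.
Proof.
elim: d S => [|d IH] S Ss xS.
  have E : #|S|.-1 = #|S :\ x| by rewrite (cardsD1 x S) xS add1n.
  rewrite perms_with_cycle_at1 Hf -E ?ffactn0 ?mul1n ?subn0 //.
  rewrite -ltnS (leq_trans _ Ss) // ltn_predL card_gt0.
  by apply/finset.set0Pn; exists x.
rewrite card_perms_with_cycle_atS //.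
transitivity (\sum_(y in S :\ x)
    (#|S|.-1.-1 ^_ d * f (#|S|.-1.-1 - d)))%N.
  apply: eq_bigr => y; rewrite !inE => /andP[yx yS].
  have E : #|S|.-1 = #|S :\ y| by rewrite (cardsD1 y S) yS add1n.
  rewrite IH -?E ?inE 1?eq_sym ?yx //.
  by apply: leq_trans Ss; apply: leq_pred.
rewrite sum_nat_const ffactnS mulnA.
have -> : #|S :\ x| = #|S|.-1 by rewrite (cardsD1 x S) xS add1n.
by rewrite -predn_sub -subnS.
Qed.

Lemma card_perms_with_cycles_rec (T : finType) (D : pred nat) (f : nat -> nat)
    (s : nat) (Hf : forall S : {set T}, (#|S| <= s)%N ->
                      #|perms_with_cycles T D S| = f #|S|)
    (S : {set T}) : #|S| = s.+1 ->
  #|perms_with_cycles T D S| =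
    (\sum_(d < s.+1 | D d.+1) s ^_ d * f (s - d))%N.
Proof.
move=> Ss; have /finset.set0Pn[x xS] : S != finset.set0 by rewrite -card_gt0 Ss.
rewrite (card_perms_with_cycles _ _ _ x) // Ss; apply: eq_bigr => d _.
by rewrite (card_perms_with_cycle_at _ _ f s) ?Ss.
Qed.

(** Both counts obey the same recurrence. The induction on the size ranges over all types, because
    [S] is compared with a set in ['I_n]. *)
Lemma card_perms_with_cyclesE (T : finType) (D : pred nat) (S : {set T}) :
  #|perms_with_cycles T D S| = num_perms_with_cycles D #|S|.
Proof.
move: {2}#|S| (leqnn #|S|) => s; elim: s T S => [|s IH] T S Ss.
  have -> : S = finset.set0 by apply/eqP; rewrite -cards_eq0 -leqn0.
  rewrite /num_perms_with_cycles perms_with_cycles0 cards0.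
  have -> : [set: 'I_0] = finset.set0 by apply/finset.setP => -[].
  by rewrite perms_with_cycles0 !cards1.
move: Ss; rewrite leq_eqVlt => /predU1P[Ss|]; last exact: IH.
rewrite (card_perms_with_cycles_rec _ _ (num_perms_with_cycles D) s) //.
  rewrite Ss /num_perms_with_cycles.
  rewrite (card_perms_with_cycles_rec _ _ (num_perms_with_cycles D) s) //.
    by move=> S'; apply: IH.
  by rewrite cardsT card_ord.
by move=> S'; apply: IH.
Qed.

(** * Densities and their recurrence *)

Definition cycle_density (R : numFieldType) (D : pred nat) (n : nat) : R :=
  (num_perms_with_cycles D n)%:R / n`!%:R.

Lemma cycle_densityS (R : numFieldType) (D : pred nat) (n : nat) :
  n.+1%:R * cycle_density R D n.+1 =
    \sum_(d < n.+1 | D d.+1) cycle_density R D (n - d).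
Proof.
rewrite /cycle_density {1}/num_perms_with_cycles.
rewrite (card_perms_with_cycles_rec _ _ (num_perms_with_cycles D) n); last first.
- by rewrite cardsT card_ord.
- by move=> S _; rewrite card_perms_with_cyclesE.
rewrite factS natrM invfM mulrCA mulVKf ?pnatr_eq0 //.
rewrite natr_sum mulr_suml; apply: eq_bigr => d _.
have dn : (d <= n)%N by rewrite -ltnS.
rewrite natrM -(ffact_fact dn) natrM invfM mulrACA divff ?mul1r //.
by rewrite pnatr_eq0 -lt0n ffact_gt0.
Qed.

Lemma cycle_density0 (R : numFieldType) (D : pred nat) :
  cycle_density R D 0 = 1.
Proof.
rewrite /cycle_density /num_perms_with_cycles.
have -> : [set: 'I_0] = finset.set0 by apply/finset.setP => -[].
by rewrite perms_with_cycles0 cards1 divr1.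
Qed.

Lemma order_dvdn_porbit (T : finType) (g : {perm T}) (m : nat) :
  (#[g]%g %| m)%N = [forall x, #|porbit g x| %| m]%N.
Proof.
apply/idP/forallP => [gm x|gm].
  apply: dvdn_trans gm; rewrite porbit.unlock.
  exact: (dvdn_orbit 'P <[g]> x).
rewrite order_dvdn; apply/eqP/permP => x; rewrite perm1 permX.
case/dvdnP: (gm x) => q ->; elim: q => //= q IH.
by rewrite mulSn iterD IH iter_porbit.
Qed.

Lemma cycle_density_ge0 (R : numFieldType) (D : pred nat) (n : nat) :
  0 <= cycle_density R D n.
Proof. by rewrite divr_ge0. Qed.

Lemma cycle_density_le1 (R : numFieldType) (D : pred nat) (n : nat) :
  cycle_density R D n <= 1.
Proof.
rewrite ler_pdivrMr ?ltr0n ?fact_gt0 // mul1r ler_nat.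
by rewrite -[leqRHS]card_Sn subset_leq_card //; apply/fintype.subsetP => g.
Qed.

Lemma cycle_density_eq1 (R : numFieldType) (D : pred nat) (n : nat) :
  (forall j, (0 < j <= n)%N -> D j) -> cycle_density R D n = 1.
Proof.
elim/ltn_ind: n => -[|n] IH Dn; first exact: cycle_density0.
apply: (@mulfI _ n.+1%:R); first by rewrite pnatr_eq0.
rewrite cycle_densityS mulr1 -[in RHS](card_ord n.+1) -sumr_const.
apply: eq_big => d; first by rewrite Dn //= ltnS -ltnS ltn_ord.
move=> _; apply: IH => [|j /andP[j0 jn]]; first by rewrite ltnS leq_subr.
by apply: Dn; rewrite j0 (leq_trans jn) // (leq_trans (leq_subr _ _)).
Qed.

Lemma cycle_density_sum (R : numFieldType) (D : pred nat) (s : seq nat)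
    (n : nat) : uniq s -> (forall d, d \in s -> (0 < d)%N) ->
  (forall d, D d -> d \in s) -> (0 < n)%N ->
  n%:R * cycle_density R D n =
    \sum_(d <- s | D d && (d <= n)%N) cycle_density R D (n - d).
Proof.
move=> us s0 Ds; case: n => // n _; rewrite cycle_densityS.
rewrite -(big_mkord (fun d => D d.+1) (fun d => cycle_density R D (n - d))).
transitivity (\sum_(1 <= d < n.+2 | D d) cycle_density R D (n.+1 - d)).
  by rewrite [RHS]big_add1.
rewrite -big_filter -[RHS]big_filter; apply: perm_big; apply: uniq_perm.
- by rewrite filter_uniq // iota_uniq.
- by rewrite filter_uniq.
move=> d; rewrite !mem_filter mem_index_iota ltnS.
case Dd: (D d) => //=; rewrite (Ds _ Dd) andbT.
by rewrite (s0 d (Ds d Dd)).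
Qed.

Lemma cycle_density_le (R : numFieldType) (D : pred nat) (s : seq nat)
    (n : nat) : uniq s -> (forall d, d \in s -> (0 < d)%N) ->
  (forall d, D d -> d \in s) -> (0 < n)%N ->
  cycle_density R D n <= (size s)%:R / n%:R.
Proof.
move=> us s0 Ds n0; rewrite ler_pdivlMr ?ltr0n // mulrC.
rewrite (cycle_density_sum _ _ s) //.
rewrite -sum1_size natr_sum big_mkcond ler_sum // => d _.
by case: ifP => // _; apply: cycle_density_le1.
Qed.

(** Since [n < 2k], at most one [k]-cycle fits, and the last term is the proportion of permutations
    having one. The proof is an induction on [e = n - k] through the recurrence. *)
Lemma cycle_density_split (R : numFieldType) (D : pred nat) (k n : nat) :
  (0 < k)%N -> D k -> (k <= n < k.*2)%N ->
  cycle_density R D n =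
    cycle_density R (fun d => D d && (d != k)) n +
      cycle_density R D (n - k) / k%:R.
Proof.
move=> k0 Dk; set D' := fun d => D d && (d != k).
have low j : (j < k)%N -> cycle_density R D j = cycle_density R D' j.
  elim/ltn_ind: j => -[|j] IH jk; first by rewrite !cycle_density0.
  apply: (@mulfI _ j.+1%:R); first by rewrite pnatr_eq0.
  rewrite !cycle_densityS; apply: eq_big => d.
    by rewrite /D'; case: eqP; rewrite ?andbT // => E; have := ltn_ord d; lia.
  by move=> _; apply: IH; lia.
move=> /andP[/subnK <-]; move: (n - k)%N => {n} e.
rewrite addnK -addnn ltn_add2r.
elim/ltn_ind: e => e IH ek.
have : (0 < e + k)%N by rewrite addn_gt0 k0 orbT.
case nE : (e + k)%N => [//|n] _.
apply: (@mulfI _ n.+1%:R); first by rewrite pnatr_eq0.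
rewrite mulrDr !cycle_densityS.
have kn : (k.-1 < n.+1)%N by lia.
rewrite (bigD1 (Ordinal kn)) /=; last by rewrite prednK.
have -> : (n - k.-1 = e)%N by lia.
(* The removed cycle now has length other than [k]. If [d < e], at least [k] points remain and the
   induction hypothesis applies; otherwise fewer than [k] remain, where [D] and [D'] give the same
   density. *)
transitivity (cycle_density R D e + \sum_(d < n.+1 | D' d.+1)
   (cycle_density R D' (n - d) +
     (if (d < e)%N then cycle_density R D (e - d.+1) / k%:R else 0))).
  congr (_ + _); apply: eq_big => d.
    by rewrite /D' -val_eqE /=; congr (_ && _); lia.
  move=> /andP[_ dk]; case: ltnP => de.
    have -> : (n - d = (e - d.+1) + k)%N by lia.
    by apply: IH; lia.
  rewrite addr0; apply: low.
  move: dk de (ltn_ord d); rewrite -val_eqE /= => dk de dn; lia.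
rewrite big_split /= addrCA; congr (_ + _).
rewrite -big_mkcondr /= -nE natrD mulrA.
(* The first summand matches the removed [k]-cycle; the second is unfolded by the recurrence at
   [e]. *)
have -> : (e%:R + k%:R) * cycle_density R D e / k%:R =
   cycle_density R D e + e%:R * cycle_density R D e / k%:R.
  by rewrite mulrDl mulrDl addrC mulrAC divff ?mul1r // pnatr_eq0 -lt0n.
congr (_ + _).
case: e {IH} ek nE => [|e] ek nE.
  by rewrite mul0r mul0r big1 // => i /andP[].
rewrite cycle_densityS mulr_suml.
rewrite -(big_mkord (fun d => D d.+1)
  (fun d => cycle_density R D (e - d) / k%:R)).
rewrite -(big_mkord (fun d => D' d.+1 && (d < e.+1)%N)
  (fun d => cycle_density R D (e.+1 - d.+1) / k%:R)).
rewrite [RHS](big_nat_widen 0 e.+1 (e.+1 + k)) ?leq_addr //.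
apply: eq_big => [d|d _]; last by rewrite subSS.
rewrite /D' -andbA; congr (_ && _).
by case: ltnP => //; rewrite ?andbT ?andbF //; lia.
Qed.

(** * The conditional probability in terms of densities *)

Lemma perms_of_order_dvdn (n m : nat) :
  [set g : 'S_n | (#[g]%g %| m)%N] =
  perms_with_cycles 'I_n (fun d => d %| m)%N [set: 'I_n].
Proof.
apply/finset.setP => g; rewrite !inE order_dvdn_porbit.
have -> : perm_on [set: 'I_n] g by apply/fintype.subsetP => x; rewrite inE.
by apply: eq_forallb => x; rewrite inE.
Qed.

Lemma perms_without_cycle (n k m : nat) :
  [set g : 'S_n | (#[g]%g %| m)%N] :\: [set g : 'S_n | contains_cycle k g] =
  perms_with_cycles 'I_n (fun d => (d %| m)%N && (d != k)) [set: 'I_n].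
Proof.
apply/finset.setP => g; rewrite !inE order_dvdn_porbit.
have -> : perm_on [set: 'I_n] g by apply/fintype.subsetP => x; rewrite inE.
apply/andP/forall_inP => [[/existsPn gk /forallP gm] x _|gD].
  rewrite gm; apply: contra (gk (porbit g x)) => /= ->.
  by rewrite andbT; apply: imset_f.
split; last by apply/forallP => x; have /andP[] := gD x (finset.in_setT x).
apply/existsPn => X; rewrite negb_and -implybE; apply/implyP => /imsetP[x _ ->].
by have /andP[] := gD x (finset.in_setT x).
Qed.

Lemma cycle_cond_probE (R : realType) (n k m : nat) :
  cycle_cond_prob R n k m =
  (cycle_density R (fun d => d %| m)%N n -
   cycle_density R (fun d => (d %| m)%N && (d != k)) n) /
  cycle_density R (fun d => d %| m)%N n.
Proof.
rewrite /cycle_cond_prob /cond_prob /unif_prob card_Sn.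
rewrite /cycle_density /num_perms_with_cycles -perms_of_order_dvdn.
rewrite -perms_without_cycle -mulrBl; congr (_ / _ / _).
set A := [set g | contains_cycle k g]; set B := [set g | _].
by rewrite -(cardsID A B) finset.setIC natrD addrK.
Qed.

(** All lengths up to [t] are allowed, so the density at [t] is 1 and the split gives
    [P = (1/k) / (b + 1/k)]. *)
Lemma cycle_cond_prob_inv (R : realType) (t k m : nat) :
  (t < k)%N -> (k %| m)%N -> (forall j, (0 < j <= t)%N -> (j %| m)%N) ->
  cycle_cond_prob R (k + t) k m =
  (1 + k%:R * cycle_density R (fun d => (d %| m)%N && (d != k)) (k + t))^-1.
Proof.
move=> tk km tm; have k0 : (0 < k)%N by apply: leq_ltn_trans tk.
rewrite cycle_cond_probE (cycle_density_split _ _ k) //; last first.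
  by rewrite leq_addr -addnn ltn_add2l.
rewrite addKn (cycle_density_eq1 _ _ t) //; set b := cycle_density _ _ _.
have kR : 0 < k%:R :> R by rewrite ltr0n.
rewrite addrAC subrr add0r div1r -invfM; congr (_^-1).
by rewrite mulrDr mulfV ?lt0r_neq0 // addrC.
Qed.

(** * The divisor bound *)

Lemma size_divisors_mul (p e m : nat) : prime p -> (0 < m)%N ->
  (size (divisors (p ^ e * m)) <= e.+1 * size (divisors m))%N.
Proof.
move=> pp m0.
have pe0 : (0 < p ^ e)%N by rewrite expn_gt0 prime_gt0.
rewrite -(size_iota 0 e.+1).
rewrite -(size_allpairs (fun i d => p ^ i * d)%N (iota 0 e.+1) (divisors m)).
apply: uniq_leq_size; first exact: divisors_uniq.
move=> d; rewrite -dvdn_divisors ?muln_gt0 ?pe0 // => dm.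
have d0 : (0 < d)%N by apply: dvdn_gt0 dm; rewrite muln_gt0 pe0.
(* [d / d1] is coprime to [p ^ e / d1], hence divides [m]. *)
pose d1 := gcdn d (p ^ e)%N.
have /(dvdn_pfactor _ _ pp)[i ie d1E] : (d1 %| p ^ e)%N by apply: dvdn_gcdr.
have d1d : (d1 %| d)%N by apply: dvdn_gcdl.
have d1_0 : (0 < d1)%N by rewrite gcdn_gt0 d0.
apply/allpairsP; exists (i, d %/ d1)%N; split.
- by rewrite [(i, _).1]/= mem_iota add0n ltnS ie.
- rewrite /= -dvdn_divisors // -(@Gauss_dvdr _ (p ^ e %/ d1)%N).
    rewrite -(@dvdn_pmul2l d1) // mulnA !(mulnC d1) divnK //.
    by rewrite divnK ?dvdn_gcdr.
  rewrite /coprime -(@eqn_pmul2l d1) // muln_gcdr muln1.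
  by rewrite !(mulnC d1) !divnK ?dvdn_gcdr.
- by rewrite -d1E mulnC divnK.
Qed.

Lemma pfactor_split (p m : nat) : prime p -> (0 < m)%N ->
  exists e m', [/\ m = (p ^ e * m')%N, (0 < m')%N & ~~ (p %| m')%N].
Proof.
move=> pp m0; exists (logn p m), (m %/ p ^ logn p m)%N.
have H := pfactor_dvdnn p m.
have pl0 : (0 < p ^ logn p m)%N by rewrite expn_gt0 prime_gt0.
split=> //; first by rewrite mulnC divnK.
  by rewrite divn_gt0 // dvdn_leq.
apply/negP => /(dvdn_mul (dvdnn (p ^ logn p m))).
by rewrite -expnSr [X in (_ %| X)%N]mulnC divnK // pfactor_dvdn // ltnn.
Qed.

(* For primes [p >= 64], [(e+1)^6 <= 2^(6e) <= p^e]; each of the finitely many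
   smaller primes only costs a constant factor. *)
Lemma size_divisors_bound_primes (B : nat) :
  exists K : nat, forall m : nat, (0 < m)%N ->
  (forall p, prime p -> (p %| m)%N -> (p < B)%N || (64 <= p)%N) ->
  (size (divisors m) ^ 6 <= K * m)%N.
Proof.
have dvdm' p e m m' : m = (p ^ e * m')%N -> forall q, (q %| m')%N -> (q %| m)%N.
  by move=> -> q qm; apply: dvdn_mull.
elim: B => [|B [K IH]].
  (* Here every prime factor is at least 64: strong induction on [m], stripping the full power of
     its least prime factor. *)
  exists 1%N => m; have [n] := ubnP m; elim: n m => // n IHn m mn m0 Hm.
  case: (ltnP 1 m) => [m1|m1]; last first.
    by have -> : m = 1%N by apply/eqP; rewrite eqn_leq m1.
  have pp := pdiv_prime m1; have pm := pdiv_dvd m.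
  have := Hm _ pp pm; rewrite ltn0 /=; move: (pdiv m) pp pm => p pp pm p64.
  have [e [m' [mE m'0 pm']]] := pfactor_split _ _ pp m0.
  have e0 : (0 < e)%N.
    by case: e mE => // mE; move: pm'; rewrite -[m']mul1n -(expn0 p) -mE pm.
  have pe : (e.+1 ^ 6 <= p ^ e)%N.
    apply: (@leq_trans (64 ^ e)); last by rewrite leq_exp2r.
    rewrite -[64%N]/(2 ^ 6)%N -expnM mulnC expnM leq_exp2r //.
    exact: ltn_expl.
  have m'm : (m' < m)%N.
    rewrite mE -{1}[m']mul1n ltn_pmul2r // -(exp1n e) ltn_exp2r //.
    exact: prime_gt1.
  have := IHn m' (leq_trans m'm mn) m'0
    (fun q qp qm => Hm q qp (dvdm' _ _ _ _ mE q qm)).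
  rewrite !mul1n => H.
  apply: (@leq_trans ((e.+1 * size (divisors m')) ^ 6)).
    by rewrite leq_exp2r // {1}mE size_divisors_mul.
  by rewrite expnMn mE leq_mul.
case: (boolP (prime B)) => [pB|npB]; last first.
  exists K => m m0 Hm; apply: IH => // p pp pm; have := Hm p pp pm.
  rewrite ltnS leq_eqVlt; case/orP=> [/orP[/eqP pE|->//]|->]; last by rewrite orbT.
  by move: npB; rewrite -pE pp.
have [C HC] : exists C : nat, forall e, (e.+1 ^ 6 <= C * 2 ^ e)%N.
  (* With [f = e %/ 6], [e + 1 <= 6 (f + 1) <= 6 * 2 ^ f], and the sixth power of [2 ^ f] is at most
     [2 ^ e]. *)
  exists (6 ^ 6)%N => e.
  apply: (@leq_trans ((6 * 2 ^ (e %/ 6)) ^ 6)).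
    rewrite leq_exp2r //; apply: (@leq_trans (6 * (e %/ 6).+1)); first lia.
    by rewrite leq_mul2l ltn_expl.
  by rewrite expnMn -expnM leq_mul2l leq_exp2l ?leq_divM ?orbT.
exists (C * K)%N => m m0 Hm.
have [e [m' [mE m'0 pm']]] := pfactor_split _ _ pB m0.
have H : (size (divisors m') ^ 6 <= K * m')%N.
  apply: IH => // p pp pm; have := Hm p pp (dvdm' _ _ _ _ mE p pm).
  rewrite ltnS leq_eqVlt; case/orP=> [/orP[/eqP pE|->//]|->]; last by rewrite orbT.
  by move: pm'; rewrite -pE pm.
apply: (@leq_trans ((e.+1 * size (divisors m')) ^ 6)).
  by rewrite leq_exp2r // {1}mE size_divisors_mul.
rewrite expnMn mE mulnACA leq_mul //.
apply: leq_trans (HC e) _; rewrite leq_mul2l.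
case: e {mE} => [|e]; first by rewrite orbT.
by rewrite leq_exp2r // prime_gt1 // orbT.
Qed.

(** At threshold 64 no prime is excluded. The sixth power makes the cube of the number of divisors
    [O(m^(1/2))], the source of the exponent 3/2. *)
Lemma size_divisors_bound : exists K : nat, forall m : nat, (0 < m)%N ->
  (size (divisors m) ^ 6 <= K * m)%N.
Proof.
have [K HK] := size_divisors_bound_primes 64; exists K => m m0.
by apply: HK => // p _ _; case: ltnP.
Qed.

(** * Permutations without the long cycle *)

(** [a = q] would give [d = k], and [a < q] would give [d >= q k / (q - 1) > k + t]. So
    [a >= q + 1], whence [d <= q k / (q + 1)]. *)
Lemma second_length (q t k d a : nat) : (0 < q)%N -> (0 < k)%N ->
  (t * q < k)%N -> d != k -> (d <= k + t)%N -> (d * a = q * k)%N ->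
  (q < a)%N /\ (k <= q.+1 * (k - d))%N.
Proof.
move=> q0 k0 tqk dk dkt da.
have qa : (q < a)%N.
  rewrite ltnNge leq_eqVlt; apply/negP => /orP[/eqP aq|aq].
    by move: dk; rewrite -(eqn_pmul2r q0) -{1}aq da mulnC eqxx.
  case: q q0 aq da tqk => // q _ aq da tqk.
  have : (d * a <= (k + t) * q)%N by rewrite leq_mul.
  rewrite da; nia.
have dk' : (d <= k)%N by rewrite -(leq_pmul2l q0) -da; nia.
split=> //; rewrite mulnBr -(leq_add2r (q.+1 * d)) subnK; last first.
  by rewrite leq_mul2l dk' orbT.
by rewrite [leqRHS]mulSn leq_add2l -da mulnC leq_mul2l qa orbT.
Qed.

(** Writing [a = q + X], [b = q + Y] and [p = (q + X)(q + Y)], one has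
    [p (k - d - d') = k (XY - q^2)]. The sign of [XY - q^2] separates the cases. *)
Lemma second_length_pair (q t k d a d' b : nat) : (0 < k)%N ->
  (t * (q + q ^ 2) ^ 2 < k)%N -> (q < a)%N -> (q < b)%N ->
  (d * a = q * k)%N -> (d' * b = q * k)%N ->
  (d + d' <= k + t)%N -> (d + d')%N != k ->
  (k <= q.+1 * (q ^ 2 + q).+1 * (k - (d + d')))%N.
Proof.
move=> k0 tk qa qb; rewrite -(subnKC qa) -(subnKC qb) !addSnnS.
move: (a - q.+1)%N (b - q.+1)%N => x y; set X := x.+1; set Y := y.+1.
have X0 : (0 < X)%N by []. have Y0 : (0 < Y)%N by [].
clearbody X Y => {x y a b qa qb} da db; move=> ek ne.
have H : ((q + X) * (q + Y) * (d + d') + k * (X * Y) =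
          k * ((q + X) * (q + Y)) + k * q ^ 2)%N.
  transitivity (d * (q + X) * (q + Y) + d' * (q + Y) * (q + X) + k * (X * Y))%N.
    by ring.
  by rewrite da db; ring.
move: (d + d')%N H ek ne => e H ek ne.
have P0 : (0 < (q + X) * (q + Y))%N by nia.
case: (ltngtP (X * Y) (q ^ 2)) => XY.
(* Here [X, Y < q^2], so [d + d' - k >= k / p > t], which is too large. *)
- have ab : ((q + X) * (q + Y) <= (q + q ^ 2) ^ 2)%N.
    by rewrite -[(_ ^ 2)%N in leqRHS]mulnn leq_mul // leq_add2l; nia.
  exfalso; move: tk H ab P0; move: ((q + X) * (q + Y))%N => p tk H ab P0.
  nia.
(* From [X + Y <= XY + 1], [p <= q^2 + q + (q + 1) XY]; the ratio to [XY - q^2] is worst when this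
   difference is 1, which gives the constant. *)
- have ab : ((q + X) * (q + Y) <= q.+1 * (q ^ 2 + q).+1 * (X * Y - q ^ 2))%N.
    have : (X + Y <= X * Y + 1)%N by nia.
    have -> : ((q + X) * (q + Y) = q ^ 2 + q * (X + Y) + X * Y)%N by ring.
    have [z zE] : exists z, (X * Y = z.+1 + q ^ 2)%N.
      by exists (X * Y - q ^ 2).-1; lia.
    rewrite zE addnK; move: (X + Y)%N => w wz; clear -wz; nia.
  move: H ab P0.
  move: ((q + X) * (q + Y))%N (q.+1 * (q ^ 2 + q).+1)%N => p C H ab P0.
  have H2 : (p * (k - e) = k * (X * Y - q ^ 2))%N by nia.
  rewrite -(leq_pmul2l P0) mulnCA H2 mulnCA.
  by rewrite -[(p * k)%N]mulnC leq_mul2l ab orbT.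
- by exfalso; move/eqP: ne; nia.
Qed.

(** Main term of [n b(n)] at [n = k + t]: a pair with [d + d' = k] leaves [t] points and has weight
    [1 / (n - d) = 1 / (d' + t)], where [t] is dropped. *)
Definition two_length_sum (R : numFieldType) (k m : nat) : R :=
  \sum_(d <- divisors m) \sum_(d' <- divisors m | (d + d')%N == k) d'%:R^-1.

Lemma invr_nat_le (R : numFieldType) (k c x : nat) :
  (0 < k)%N -> (k <= c * x)%N -> x%:R^-1 <= c%:R / k%:R :> R.
Proof.
move=> k0 kcx; have x0 : (0 < x)%N.
  by case: x kcx => //; rewrite muln0; case: k k0.
rewrite ler_pdivlMr ?ltr0n // ler_pdivrMl ?ltr0n // mulrC -natrM mulnC.
by rewrite mulnC ler_nat.
Qed.

(** * Unfolding the recurrence twice *)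

Section TwoLengths.
Variables (R : realType) (q t k : nat).
Hypotheses (q0 : (0 < q)%N) (k0 : (0 < k)%N) (kt : (t * (q + q ^ 2) ^ 2 < k)%N).
Local Notation m := (q * k)%N.
Local Notation D := (fun d => (d %| m)%N && (d != k)).
Local Notation s := (divisors m).
Local Notation b := (cycle_density R D).
Local Notation E := (q.+1 * (q.+1 * (q ^ 2 + q).+1))%N.

Local Lemma m0 : (0 < m)%N. Proof. by rewrite muln_gt0 q0. Qed.

Local Lemma s0 d : d \in s -> (0 < d)%N.
Proof. by rewrite -dvdn_divisors ?m0 //; apply: dvdn_gt0; apply: m0. Qed.

Local Lemma Ds d : D d -> d \in s.
Proof. by case/andP; rewrite dvdn_divisors ?m0. Qed.

Local Lemma tqk : (t * q < k)%N.
Proof. by apply: leq_ltn_trans kt; rewrite leq_mul2l; apply/orP; right; nia. Qed.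

Local Lemma density_sum n : (0 < n)%N ->
  n%:R * b n = \sum_(d <- s | D d && (d <= n)%N) b (n - d).
Proof. exact: cycle_density_sum (divisors_uniq _) s0 Ds. Qed.

Local Lemma D_lt d : D d -> (d <= k + t)%N ->
  exists a, [/\ (d * a = q * k)%N, (q < a)%N & (k <= q.+1 * (k - d))%N].
Proof.
move=> /andP[/dvdnP[a da] dk] dkt; rewrite [RHS]mulnC in da.
have [qa kd] := second_length _ _ _ _ _ q0 k0 tqk dk dkt (esym da).
by exists a.
Qed.

(** For [d + d' <> k], [E] collects two losses: [k + t - d >= k / (q + 1)], and the number of
    remaining points is at least [k] over the constant of [second_length_pair]. *)
Local Lemma density_upper_step d : D d -> (d <= k + t)%N ->
  b (k + t - d) <= \sum_(d' <- s | (d + d')%N == k) d'%:R^-1 +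
     (size s ^ 2 * E)%:R / k%:R ^+ 2.
Proof.
move=> Dd dkt; have [a [da qa kd]] := D_lt d Dd dkt.
have dk : (d < k)%N by rewrite -subn_gt0; nia.
have n0 : (0 < k + t - d)%N by lia.
have nR : 0 < (k + t - d)%:R :> R by rewrite ltr0n.
have kR : 0 < k%:R :> R by rewrite ltr0n.
(* The error is shared equally among the divisors [d'], so that the comparison is termwise. *)
have -> : (size s ^ 2 * E)%:R / k%:R ^+ 2 =
    \sum_(d' <- s) (size s * E)%:R / k%:R ^+ 2 :> R.
  rewrite big_const_seq count_predT iter_addr_0 -[RHS]mulr_natl mulrA -natrM.
  by rewrite -mulnn -!mulnA.
rewrite [X in _ <= X + _]big_mkcond -big_split /=.
rewrite -(ler_pM2l nR) density_sum // mulr_sumr big_mkcond.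
apply: ler_sum => d' _; case: ifP => [/andP[Dd' d'n]|_]; last first.
  rewrite mulr_ge0 ?addr_ge0 ?divr_ge0 ?exprn_ge0 //.
  by case: ifP => _; rewrite ?invr_ge0.
have d'0 : (0 < d')%N by apply: s0; apply: Ds.
case: eqP => [ddk|/eqP ddk].
  apply: (@le_trans _ _ 1); first exact: cycle_density_le1.
  rewrite mulrDr -[leLHS]addr0 lerD ?mulr_ge0 ?divr_ge0 ?exprn_ge0 //.
  by rewrite ler_pdivlMr ?ltr0n // mul1r ler_nat; lia.
have d'kt : (d' <= k + t)%N by lia.
have [a' [da' qa' kd']] := D_lt d' Dd' d'kt.
have ddkt : (d + d' <= k + t)%N by lia.
have := second_length_pair _ _ _ _ _ _ _ k0 kt qa qa' da da' ddkt ddk.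
set C := (q.+1 * (q ^ 2 + q).+1)%N => kC.
have e0 : (0 < k - (d + d'))%N.
  by rewrite lt0n; apply: contraTneq kC => ->; rewrite muln0 -ltnNge.
have -> : (k + t - d - d' = k - (d + d') + t)%N by lia.
apply: (le_trans (cycle_density_le R D s _ (divisors_uniq _) s0 Ds _)).
  by rewrite addn_gt0 e0.
rewrite add0r.
have H1 : (k - (d + d') + t)%:R^-1 <= C%:R / k%:R :> R.
  apply: invr_nat_le => //; apply: leq_trans kC _.
  by rewrite leq_mul2l leq_addr orbT.
have H2 : 1 <= (k + t - d)%:R * (q.+1%:R / k%:R) :> R.
  rewrite mulrA ler_pdivlMr // mul1r -natrM ler_nat mulnC.
  by apply: leq_trans kd _; rewrite leq_mul2l; apply/orP; right; lia.
apply: (@le_trans _ _ ((size s)%:R * (C%:R / k%:R))).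
  by rewrite ler_wpM2l.
rewrite -[leLHS]mul1r.
have -> : (size s * E)%:R / k%:R ^+ 2 =
   (q.+1%:R / k%:R) * ((size s)%:R * (C%:R / k%:R)) :> R.
  by rewrite -/C !natrM; field; rewrite lt0r_neq0.
by rewrite [leRHS]mulrA ler_wpM2r ?mulr_ge0 ?divr_ge0.
Qed.

Lemma density_two_length_upper :
  (k + t)%:R * b (k + t) <=
    two_length_sum R k m + (size s ^ 3 * E)%:R / k%:R ^+ 2.
Proof.
rewrite density_sum ?addn_gt0 ?k0 //.
have -> : (size s ^ 3 * E)%:R / k%:R ^+ 2 =
    \sum_(d' <- s) (size s ^ 2 * E)%:R / k%:R ^+ 2 :> R.
  rewrite big_const_seq count_predT iter_addr_0 -[RHS]mulr_natl mulrA -natrM.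
  by rewrite expnS -!mulnA.
rewrite -big_split /= big_mkcond; apply: ler_sum => d _.
case: ifP => [/andP[Dd dkt]|_]; first exact: density_upper_step.
rewrite addr_ge0 ?divr_ge0 ?exprn_ge0 //.
by apply: sumr_ge0 => d' _; rewrite invr_ge0.
Qed.

(** Only pairs with [d + d' = k] are kept. Since [d' >= k / (q + 1)], replacing [1 / (d' + t)] by
    [1 / d'] costs a relative error of at most [t (q + 1) / k]. *)
Lemma density_two_length_lower : (forall j, (0 < j <= t)%N -> (j %| m)%N) ->
  two_length_sum R k m * (1 - (t * q.+1)%:R / k%:R) <= (k + t)%:R * b (k + t).
Proof.
move=> tm; have kR : 0 < k%:R :> R by rewrite ltr0n.
have tk : (t < k)%N by apply: leq_ltn_trans tqk; rewrite leq_pmulr.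
have bt : b t = 1.
  apply: cycle_density_eq1 => j /andP[j0 jt]; rewrite tm ?j0 //=.
  by rewrite neq_ltn (leq_ltn_trans jt).
rewrite density_sum ?addn_gt0 ?k0 // mulr_suml [leRHS]big_mkcond.
rewrite big_seq [leRHS]big_seq; apply: ler_sum => d ds.
case: ifP => [/andP[Dd dkt]|Dd]; last first.
  (* An excluded divisor [d] equals [k] or exceeds [k + t], so no positive [d'] completes it to
     [k]. *)
  rewrite big_seq_cond big1 ?mul0r // => d' /andP[ds' /eqP ddk].
  have d'0 := s0 _ ds'; have dm : (d %| m)%N by rewrite dvdn_divisors ?m0.
  by move: Dd; rewrite dm /=; lia.
have [a [da qa kd]] := D_lt d Dd dkt.
have dk : (d < k)%N by rewrite -subn_gt0; nia.
have n0 : (0 < k + t - d)%N by lia.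
have nR : 0 < (k + t - d)%:R :> R by rewrite ltr0n.
rewrite -(ler_pM2l nR) density_sum // mulr_suml mulr_sumr.
rewrite big_mkcond [leRHS]big_mkcond big_seq [leRHS]big_seq.
apply: ler_sum => d' ds'; have d'0 := s0 _ ds'.
case: eqP => ddk; last by case: ifP => // _; apply: cycle_density_ge0.
have d'm : (d' %| m)%N by rewrite dvdn_divisors ?m0.
have d'k : (d' != k)%N by have := s0 _ ds; lia.
rewrite d'm d'k /= ifT; last lia.
have -> : (k + t - d - d' = t)%N by lia.
have d'R : 0 < d'%:R :> R by rewrite ltr0n.
have -> : (k + t - d = d' + t)%N by lia.
rewrite bt natrD natrM.
have : q.+1%:R / k%:R >= d'%:R^-1 :> R.
  by apply: invr_nat_le => //; rewrite (_ : d' = k - d)%N //; lia.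
set x := d'%:R^-1; set y := _ / k%:R => xy.
have x0 : 0 < x by rewrite invr_gt0.
have dx : d'%:R * x = 1 by rewrite mulfV ?lt0r_neq0.
have tR : 0 <= t%:R :> R by [].
rewrite -mulrA -/y.
have -> : (d'%:R + t%:R) * (x * (1 - t%:R * y)) =
    (1 + t%:R * x) * (1 - t%:R * y).
  by rewrite mulrA mulrDl dx.
have -> : (1 + t%:R * x) * (1 - t%:R * y) =
    1 - t%:R * (y - x) - t%:R ^+ 2 * (x * y) by ring.
have ty : 0 <= t%:R * (y - x) by rewrite mulr_ge0 // subr_ge0.
have txy : 0 <= t%:R ^+ 2 * (x * y).
  by rewrite mulr_ge0 ?exprn_ge0 // mulr_ge0 ?ltW // (lt_le_trans x0).
lra.
Qed.
End TwoLengths.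

(** * The constants of the two parts *)

(** Shift [i] and [j] by one: [r + i = (r + 1) + (i - 1)]. Part (b) thus takes the form of (a) with
    [q = r + 1]. *)
Lemma c'_constE (R : realType) (r k : nat) :
  c'_const R r (r.+1 * k) = c_const R r.+1 k.
Proof.
rewrite /c'_const /c_const big_add1; apply: eq_bigr => i _.
rewrite big_add1; apply: eq_big => j; first by rewrite !addnS !addSn.
by move=> _; rewrite -![_.+1%:R]natr1; congr (1 + _ / _); ring.
Qed.

Lemma big_pair_cond (R : numFieldType) (I J : Type) (r1 : seq I) (r2 : seq J)
    (P : I -> J -> bool) (F : I -> J -> R) :
  \sum_(i <- r1) \sum_(j <- r2 | P i j) F i j =
  \sum_(p <- [seq (i, j) | i <- r1, j <- r2] | P p.1 p.2) F p.1 p.2.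
Proof.
rewrite [RHS]big_mkcond big_allpairs_dep /=; apply: eq_bigr => i _.
by rewrite big_mkcond.
Qed.

(** Clearing denominators, [(q + i)(q + j)(d + d' - k) = k (q^2 - ij)]. *)
Lemma add_codivisors (q k i j d d' : nat) : (0 < q)%N -> (0 < k)%N ->
  (d * (q + i) = q * k)%N -> (d' * (q + j) = q * k)%N ->
  ((d + d')%N == k) = (i * j == q ^ 2)%N.
Proof.
move=> q0 k0 di dj.
have H : ((q + i) * (q + j) * (d + d') + k * (i * j) =
          (q + i) * (q + j) * k + k * q ^ 2)%N.
  transitivity (d * (q + i) * (q + j) + d' * (q + j) * (q + i) + k * (i * j))%N.
    by ring.
  by rewrite di dj; ring.
have P0 : (0 < (q + i) * (q + j))%N by rewrite muln_gt0 !addn_gt0 q0.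
apply/eqP/eqP => E; move: H; rewrite E.
  by move/addnI/eqP; rewrite eqn_pmul2l // => /eqP.
by move/addIn/eqP; rewrite eqn_pmul2l // => /eqP.
Qed.

(* [ij = q^2] amounts to [1/(q+i) + 1/(q+j) = 1/q], that is, to
   [qk/(q+i) + qk/(q+j) = k]. *)
Lemma c_constE (R : realType) (q k : nat) : (0 < q)%N -> (0 < k)%N ->
  c_const R q k = k%:R * two_length_sum R k (q * k).
Proof.
move=> q0 k0; set m := (q * k)%N; have m0 : (0 < m)%N by rewrite muln_gt0 q0.
rewrite /c_const /two_length_sum -/m; set s := divisors m.
have sP d : (d \in s) = (d %| m)%N by rewrite dvdn_divisors.
set I := index_iota 1 (q ^ 2).+1.
pose P (i j : nat) := [&& (i * j == q ^ 2)%N, (q + i %| m)%N & (q + j %| m)%N].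
pose phi (p : nat * nat) := (m %/ (q + p.1), m %/ (q + p.2))%N.
pose L1 := [seq p <- [seq (i, j) | i <- I, j <- I] | P p.1 p.2].
pose L2 := [seq p <- [seq (i, j) | i <- s, j <- s] | (p.1 + p.2 == k)%N].
have L12 : perm_eq (map phi L1) L2.
  apply: uniq_perm.
  - rewrite map_inj_in_uniq; last first.
      move=> [i j] [i' j']; rewrite !mem_filter /=.
      move=> /andP[/and3P[_ iM jM] _] /andP[/and3P[_ iM' jM'] _] [Ei Ej].
      have inj x x' : (q + x %| m)%N -> (q + x' %| m)%N ->
          (m %/ (q + x) = m %/ (q + x'))%N -> x = x'.
        move=> xM xM' xx; apply: (@addnI q); apply/eqP.
        have x0 : (0 < m %/ (q + x))%N.
          by move: m0; rewrite -{1}(divnK xM) muln_gt0 => /andP[].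
        by rewrite -(eqn_pmul2l x0) {2}xx ![(_ %/ _ * _)%N]divnK.
      by rewrite (inj _ _ iM iM' Ei) (inj _ _ jM jM' Ej).
    by rewrite filter_uniq // allpairs_uniq ?iota_uniq // => -[? ?] [? ?].
  - by rewrite filter_uniq // allpairs_uniq ?divisors_uniq // => -[? ?] [? ?].
  move=> [d d']; rewrite mem_filter /=; apply/mapP/idP.
    move=> [[i j]]; rewrite mem_filter /= => /andP[/and3P[ij iM jM] _] [-> ->].
    rewrite (add_codivisors q k i j) ?divnK // ij /=.
    apply/allpairsP; exists (m %/ (q + i), m %/ (q + j))%N.
    by rewrite /= !sP; split=> //; [rewrite -{2}(divnK iM)|rewrite -{2}(divnK jM)];
      rewrite dvdn_mulr.
  move=> /andP[/eqP ddk /allpairsP[[x y] /= [xs ys [dx d'y]]]].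
  move: xs ys; rewrite -{x}dx -{y}d'y !sP => dm d'm.
  (* Surjectivity: in a pair of divisors with sum [k] each is below [k], so its codivisor exceeds
     [q] and has the form [q + z] with [z > 0]. *)
  have lt x y : (x %| m)%N -> (y %| m)%N -> (x + y)%N = k ->
      exists2 z, (x * (q + z) = m)%N & (0 < z)%N.
    move=> /dvdnP[a ma] ym xyk.
    have y0 : (0 < y)%N by apply: dvdn_gt0 ym.
    have qa : (q < a)%N.
      rewrite ltnNge; apply/negP => aq.
      have : (q * k <= q * x)%N by rewrite -/m ma leq_mul2r aq orbT.
      by rewrite leq_pmul2l //; lia.
    by exists (a - q)%N; [rewrite subnKC ?(ltnW qa) // mulnC|rewrite subn_gt0].
  have [i di i0] := lt _ _ dm d'm ddk.
  have [j dj j0] := lt _ _ d'm dm (etrans (addnC _ _) ddk).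
  have /eqP ij : (i * j == q ^ 2)%N.
    by rewrite -(add_codivisors q k i j d d') ?ddk.
  have phiE x z : (x * (q + z) = m)%N -> (m %/ (q + z))%N = x.
    by move=> <-; rewrite mulnK // addn_gt0 q0.
  exists (i, j); last by rewrite /phi /= (phiE d i) ?(phiE d' j).
  rewrite mem_filter /P /= ij eqxx -{1}di -{1}dj !dvdn_mull //=.
  apply/allpairsP; exists (i, j); rewrite /= !mem_index_iota i0 j0 !ltnS -ij.
  by split=> //; [apply: leq_pmulr|apply: leq_pmull].
rewrite !big_pair_cond -big_filter -[in RHS]big_filter -/L1 -/L2.
(* With [d = m / (q + i)] and [d' = m / (q + j)], the summand of [c] is [k/2] times [1/d + 1/d'];
   exchanging [d] and [d'] then merges the two halves. *)
transitivity (k%:R / 2 * \sum_(p <- L2) (p.1%:R^-1 + p.2%:R^-1) : R).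
  rewrite -(perm_big _ L12) big_map mulr_sumr big_seq [RHS]big_seq.
  apply: eq_bigr => -[i j]; rewrite mem_filter /= => /andP[/and3P[_ iM jM] _].
  have inv x : (q + x %| m)%N ->
      (m %/ (q + x))%:R^-1 = (q%:R + x%:R) / (q%:R * k%:R) :> R.
    move=> xm; rewrite -natrM -/m -{2}(divnK xm) natrM invfM.
    rewrite mulrCA -natrD divff ?mulr1 // pnatr_eq0; lia.
  rewrite !inv //; field.
  by rewrite !pnatr_eq0 -!lt0n q0 k0.
rewrite big_split /= mulrDr.
have -> : \sum_(p <- L2) p.1%:R^-1 = \sum_(p <- L2) p.2%:R^-1 :> R.
  pose Q (i j : nat) := (i + j == k)%N.
  rewrite !big_filter -(big_pair_cond _ _ _ _ _ Q (fun i j => i%:R^-1)).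
  rewrite -(big_pair_cond _ _ _ _ _ Q (fun i j => j%:R^-1)).
  rewrite (exchange_big_dep xpredT) //=.
  apply: eq_bigr => i _; apply: eq_bigl => j; by rewrite /Q addnC.
by rewrite -mulrDl -splitr.
Qed.

(** Dropping the conditions on [i] and [j], all terms being nonnegative, leaves a sum independent of
    [k]. *)
Lemma c_const_bounds (R : realType) (q : nat) : exists C : R, forall k : nat,
  0 <= c_const R q k <= C.
Proof.
exists (\sum_(1 <= i < (q ^ 2).+1) \sum_(1 <= j < (q ^ 2).+1)
  (1 + (i%:R + j%:R) / (2 * q%:R))) => k.
have F0 i j : 0 <= 1 + (i%:R + j%:R) / (2 * q%:R) :> R.
  by rewrite addr_ge0 // divr_ge0 ?addr_ge0 ?mulr_ge0.
rewrite /c_const; apply/andP; split.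
  by do 2 apply: sumr_ge0 => ? _.
apply: ler_sum => i _; rewrite big_mkcond; apply: ler_sum => j _.
by case: ifP.
Qed.

(** * The estimate *)

Lemma bigO_inv_pow_o1_powR (R : realType) (a A : R) :
  bigO_inv_pow_o1 a (fun n => A * n%:R `^ (- a)).
Proof.
move=> eps eps0; apply/eqO_exP; exists (`|A| + 1).
  by rewrite ltr_wpDl.
exists 1%N => // n /= n1; rewrite normrM.
have n1R : 1 <= n%:R :> R by rewrite ler1n.
apply: (@le_trans _ _ ((`|A| + 1) * `|n%:R `^ (- a)|)).
  by rewrite ler_wpM2r // lerDl.
rewrite ler_wpM2l ?addr_ge0 // !ger0_norm ?powR_ge0 //.
by apply: ler_powR => //; rewrite lerDl ltW.
Qed.

Lemma bigO_inv_sqr (R : realType) (B : R) :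
  ((fun n : nat => B * (1 / n%:R ^+ 2)%R : R) =O_\oo
     (fun n : nat => (1 / n%:R ^+ 2)%R : R))%classic.
Proof.
apply/eqO_exP; exists (`|B| + 1); first by rewrite ltr_wpDl.
exists 1%N => // n /= n1; rewrite normrM.
by rewrite ler_wpM2r // lerDl.
Qed.

Lemma powR_inv_3_2 (R : realType) (n : nat) : (0 < n)%N ->
  n%:R `^ (- (3 / 2)) = Num.sqrt n%:R / n%:R ^+ 2 :> R.
Proof.
move=> n0; have nR : n%:R != 0 :> R by rewrite pnatr_eq0 -lt0n.
have -> : - (3 / 2) = 2^-1 + - 2%:R :> R by lra.
by rewrite powRD ?nR ?implybT // powR12_sqrt // powRN powR_mulrn.
Qed.

(** Because [(1 - u)(1 + u) <= 1] and [(1 - v + v^2)(1 + v) = 1 + v^3]. It is applied to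
    [u = k b(n)] and a lower bound [v] of it. *)
Lemma invr1D_bounds (R : realFieldType) (u v : R) : 0 <= v -> v <= u ->
  1 - u <= (1 + u)^-1 <= 1 - v + v ^+ 2.
Proof.
move=> v0 vu; have u0 : 0 <= u by apply: le_trans vu.
have u1 : 0 < 1 + u by lra.
have v1 : 0 < 1 + v by lra.
apply/andP; split; first by rewrite -[(1 + u)^-1]mul1r ler_pdivlMr //; nra.
apply: (@le_trans _ _ (1 + v)^-1); first by rewrite lef_pV2 ?posrE //; lra.
by rewrite -[(1 + v)^-1]mul1r ler_pdivrMr //; nra.
Qed.

Lemma cycle_estimate_residual (R : realType) (q t : nat) : (0 < q)%N ->
  (forall j, (0 < j <= t)%N -> (j %| q)%N) ->
  cycle_estimate (fun n => cycle_cond_prob R n (n - t)%N (q * (n - t))%N)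
                 (fun n => c_const R q (n - t)%N).
Proof.
move=> q0 qt; have [C HC] := c_const_bounds R q.
have [K HK] := size_divisors_bound.
set E := (q.+1 * (q.+1 * (q ^ 2 + q).+1))%N.
(* In [A], the root comes from the divisor bound and the 2 from [n <= 2k]. In [B], the first term is
   the relative error of the lower bound on [b(n)], the second bounds [v^2]. *)
pose A : R := 2 * E%:R * Num.sqrt (K * q)%:R.
pose B : R := 2 * C * (t * q.+1)%:R + C ^+ 2.
exists (fun n => A * n%:R `^ (- (3 / 2))), (fun n => B * (1 / n%:R ^+ 2)).
split; [exact: bigO_inv_pow_o1_powR|exact: bigO_inv_sqr|].
(* For such [n], [k = n - t] satisfies [t (q + q^2)^2 < k], [t < k] and [t (q + 1) <= k]. *)
exists (t * (q + q ^ 2) ^ 2 + t * q.+1 + t + t + 1)%N => // n /= Nn.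
have [k nE] : exists k, n = (k + t)%N by exists (n - t)%N; rewrite subnK //; lia.
move: Nn; rewrite {}nE addnK => Nn.
have k0 : (0 < k)%N by lia.
have kt : (t * (q + q ^ 2) ^ 2 < k)%N by lia.
have tk : (t < k)%N by lia.
have tqk : (t * q.+1 <= k)%N by lia.
have tm j : (0 < j <= t)%N -> (j %| q * k)%N by move=> /qt jq; rewrite dvdn_mulr.
have := density_two_length_upper R q t k q0 k0 kt.
have := density_two_length_lower R q t k q0 k0 kt tm.
rewrite /= -/E cycle_cond_prob_inv ?dvdn_mull //.
set b := cycle_density _ _ _; set M := two_length_sum _ _ _ => lo up.
have /andP[c0 cC] := HC k.
have cE : c_const R q k = k%:R * M by apply: c_constE.
move: c0 cC cE; set c := c_const R q k => c0 cC cE.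
have kR : 0 < k%:R :> R by rewrite ltr0n.
have nR : 0 < (k + t)%:R :> R by rewrite ltr0n addn_gt0 k0.
have n2k : (k + t)%:R <= 2 * k%:R :> R by rewrite -natrM ler_nat; lia.
have s3 : (size (divisors (q * k)) ^ 3)%:R <=
    Num.sqrt (K * q)%:R * Num.sqrt (k + t)%:R :> R.
  rewrite -sqrtrM // -natrM -[leLHS]ger0_norm // -sqrtr_sqr ler_wsqrtr //.
  rewrite -natrX ler_nat -expnM.
  apply: leq_trans (HK _ _) _; first by rewrite muln_gt0 q0.
  by rewrite mulnA leq_mul2l leq_addr orbT.
rewrite powR_inv_3_2 ?addn_gt0 ?k0 //.
move: (size _ ^ 3)%N s3 up => T s3 up.
set N : R := (k + t)%:R in nR n2k s3 up lo *.
clearbody N; clear HK Nn kt tk tm.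
set w : R := (t * q.+1)%:R in lo *.
have w0 : 0 <= w by [].
have wk : w / k%:R <= 1 by rewrite ler_pdivrMr // mul1r ler_nat.
set u := k%:R * b.
(* Since [c = k M], the factor [k] in [u = k b] is absorbed and the main term is [c] over [n], not
   over [k]. *)
have uN : c / N * (1 - w / k%:R) <= u.
  rewrite mulrAC ler_pdivrMr // cE -mulrA /u -mulrA ler_pM2l //.
  by rewrite [b * N]mulrC.
have Nu : u <= c / N + A * (Num.sqrt N / N ^+ 2).
  have -> : c / N + A * (Num.sqrt N / N ^+ 2) = (c + A * Num.sqrt N / N) / N.
    by field; rewrite lt0r_neq0.
  rewrite ler_pdivlMr // /u -mulrA [b * N]mulrC.
  apply: (@le_trans _ _ (k%:R * (M + (T * E)%:R / k%:R ^+ 2))).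
    by rewrite ler_pM2l.
  rewrite mulrDr -cE lerD2l.
  have -> : k%:R * ((T * E)%:R / k%:R ^+ 2) = (T * E)%:R / k%:R :> R.
    by field; rewrite lt0r_neq0.
  rewrite ler_pdivrMr // mulrAC ler_pdivlMr //.
  apply: (@le_trans _ _ ((T * E)%:R * (2 * k%:R))); first by rewrite ler_wpM2l.
  have -> : A * Num.sqrt N * k%:R =
      Num.sqrt (K * q)%:R * Num.sqrt N * E%:R * (2 * k%:R) by rewrite /A; ring.
  by rewrite natrM ler_wpM2r ?mulr_ge0 ?ler_wpM2r // ltW.
have v0 : 0 <= c / N * (1 - w / k%:R).
  by rewrite mulr_ge0 ?divr_ge0 ?subr_ge0 // ltW.
have /andP[P1 P2] := invr1D_bounds _ _ _ v0 uN.
split; first by apply: le_trans P1; lra.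
apply: (le_trans P2).
have C0 : 0 <= C by apply: le_trans cC.
have cN : 0 <= c / N by rewrite divr_ge0 // ltW.
have wk0 : 0 <= w / k%:R by rewrite divr_ge0 // ltW.
have sq : (c / N * (1 - w / k%:R)) ^+ 2 <= C ^+ 2 / N ^+ 2.
  rewrite -expr_div_n ler_sqr ?nnegrE //; last by rewrite divr_ge0 // ltW.
  apply: (@le_trans _ _ (c / N)); first by rewrite ler_piMr //; lra.
  by rewrite ler_pM2r ?invr_gt0.
have cr : c / N * (w / k%:R) <= 2 * C * w / N ^+ 2.
  rewrite mulf_div ler_pdivrMr ?mulr_gt0 // mulrAC ler_pdivlMr ?exprn_gt0 //.
  apply: (@le_trans _ _ (C * w * (N * (2 * k%:R)))); last first.
    by rewrite le_eqVlt; apply/orP; left; apply/eqP; ring.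
  by rewrite expr2 ler_pM ?mulr_ge0 ?ler_wpM2r ?ler_wpM2l // ltW.
have -> : B * (1 / N ^+ 2) = 2 * C * w / N ^+ 2 + C ^+ 2 / N ^+ 2.
  by rewrite /B -/w; ring.
lra.
Qed.

Theorem corollary1p4 (R : realType) (r : nat) (hr : (0 < r)%N) :
  cycle_estimate (fun n : nat => cycle_cond_prob R n n (r * n)%N)
                 (fun n : nat => c_const R r n)
  /\
  (forall t : nat, (0 < t)%N -> r = (t`! - 1)%N ->
     cycle_estimate
       (fun n : nat => cycle_cond_prob R n (n - t)%N (t`! * (n - t))%N)
       (fun n : nat => c'_const R r (t`! * (n - t))%N)).
Proof.
split.
  have := cycle_estimate_residual R r 0 hr; under eq_fun do rewrite subn0.
  under [X in _ _ X]eq_fun do rewrite subn0.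
  by apply=> j /andP[]; case: j.
(* The subtraction in [r = t! - 1] does not truncate, as [t! >= 1]. *)
move=> t t0 rE; have rt : r.+1 = t`! by rewrite rE subn1 prednK ?fact_gt0.
have -> : (fun n => c'_const R r (t`! * (n - t))) =
    fun n => c_const R r.+1 (n - t).
  by apply/funext => n; rewrite -rt c'_constE.
rewrite -rt; apply: cycle_estimate_residual => // j /andP[j0 jt].
by rewrite rt dvdn_fact // j0.
Qed.
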